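(* There is an absolute constant $c>0$ such that for every $p=p(n)$ with $n^{-1}\le p\le 1$, with probability tending to $1$ as $n\to\infty$ the random graph $G=G(n,p)$ satisfies $$\operatorname{minrank}_{\mathbb{F}}(G)\ \ge\ c\,\frac{n\log(1/p)}{\log n}\quad\text{simultaneously for every field }\mathbb{F}.$$
   Context: For a graph $G$ on vertex set $[n]$ and a field $\mathbb{F}$, $\operatorname{minrank}_{\mathbb{F}}(G)$ is the minimum rank of a matrix $M\in\mathbb{F}^{n\times n}$ with all diagonal entries nonzero such that $M_{i,j}=0$ whenever $i\neq j$ and $i,j$ are nonadjacent in $G$. $G(n,p)$ denotes the binomial random graph on $[n]$ in which each pair is an edge independently with probability $p$. *)

(* Defs.v *)
From HB Require Import structures.
From Stdlib Require Import Reals ClassicalEpsilon.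
From mathcomp Require Import all_boot all_order all_algebra.
Set Implicit Arguments. Unset Strict Implicit. Unset Printing Implicit Defensive.
Import GRing.Theory.
Local Open Scope ring_scope.

Definition represents (F : fieldType) (n : nat) (adj : rel 'I_n) (M : 'M[F]_n) : Prop :=
  (forall i, M i i != 0) /\ (forall i j, i != j -> ~~ adj i j -> M i j = 0).

Lemma represents_id (F : fieldType) (n : nat) (adj : rel 'I_n) :
  represents adj (1%:M : 'M[F]_n).
Proof.
split.
- by move=> i; rewrite mxE eqxx /= oner_neq0.
- by move=> i j /negbTE Hij _; rewrite mxE Hij.
Qed.

Definition mr_pred (F : fieldType) (n : nat) (adj : rel 'I_n) : pred nat :=
  fun k => if excluded_middle_informative
                (exists M : 'M[F]_n, represents adj M /\ \rank M = k)
           then true else false.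

Lemma mr_ex (F : fieldType) (n : nat) (adj : rel 'I_n) : exists k, mr_pred F adj k.
Proof.
exists (\rank (1%:M : 'M[F]_n)); rewrite /mr_pred.
case: excluded_middle_informative => // H; exfalso; apply: H.
by exists 1%:M; split; [exact: represents_id|].
Qed.

Definition minrank (F : fieldType) (n : nat) (adj : rel 'I_n) : nat :=
  ex_minn (mr_ex F adj).

Local Close Scope ring_scope.
Local Open Scope R_scope.

(* Binomial random graph G(n,p) on vertex set 'I_n: the outcome is the edge set
   E, a set of pairs (i,j) with i < j; each such pair is present independently
   with probability p. *)
Definition all_pairs (n : nat) : {set 'I_n * 'I_n} := [set ij : 'I_n * 'I_n | (ij.1 < ij.2)%N].

Definition gadj (n : nat) (E : {set 'I_n * 'I_n}) : rel 'I_n :=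
  fun i j => ((i, j) \in E) || ((j, i) \in E).

Definition gnp_weight (n : nat) (p : R) (E : {set 'I_n * 'I_n}) : R :=
  (pow p #|E| * pow (1 - p) (#|all_pairs n| - #|E|)).

Definition gnp_prob (n : nat) (p : R) (P : rel 'I_n -> Prop) : R :=
  \big[Rplus/0]_(E : {set 'I_n * 'I_n} | E \subset all_pairs n)
     (gnp_weight p E * (if excluded_middle_informative (P (gadj E)) then 1 else 0)).
Arguments gnp_prob : clear implicits.

(* Main.v *)
(* If M represents G and has small rank k, a principal submatrix minimising
   rank/size has, by a greedy choice, a row basis and a column basis which are
   both proportionally sparse.  Its support is then the zero pattern of a family
   of bordered determinants in few variables, so there are few possible supports,
   while each of them has so many off-diagonal entries that G is unlikely to
   contain all the corresponding edges.

   Zero patterns are counted over all fields at once, as in Nelson's count of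
   representable matroids: if S_1, ..., S_k are patterns and g_i is the product of
   the integer polynomials indexed by S_i, two sums of g_i's over distinct index
   sets X and Y agree on an integer grid by pigeonhole, hence agree identically.
   Evaluating their difference, whose coefficients are 0 or +1 or -1, at a witness
   of a minimal pattern in the symmetric difference of X and Y is a contradiction
   in any characteristic. *)
Require Import Defs.
From HB Require Import structures.
From Stdlib Require Import Reals Lra ClassicalEpsilon.
From mathcomp Require Import all_boot all_order all_algebra.
From mathcomp Require Import boolp Rstruct.
From mathcomp Require Import zify.
From mathcomp Require Import mpoly.
Set Implicit Arguments. Unset Strict Implicit. Unset Printing Implicit Defensive.
Import Order.TTheory GRing.Theory Num.Theory.
Local Open Scope ring_scope.

(** * Counting zero patterns over all fields *)

(** Naturality in the ring makes [h] the evaluation of one integer polynomial without naming it; the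
    second hypothesis bounds its degree in each variable by [D]. Vanishing on the grid then makes it
    zero over the integers, hence over every field. *)
Lemma grid_vanishing (N D : nat)
    (h : forall R : comNzRingType, ('I_N -> R) -> R) :
    (forall (R S : comNzRingType) (phi : {rmorphism R -> S}) (v : 'I_N -> R),
        phi (h R v) = h S (fun i => phi (v i))) ->
    (forall (R : idomainType) (v : 'I_N -> R) (i : 'I_N),
        (size (h {poly R} (fun j => if j == i then 'X else (v j)%:P)) <= D.+1)%N) ->
    (forall a : {ffun 'I_N -> 'I_D.+1}, h int (fun i => (a i)%:R) = 0) ->
  forall (F : fieldType) (u : 'I_N -> F), h F u = 0.
Proof.
move=> hnat hdeg h0 F u.
have hext (R : comNzRingType) (v w : 'I_N -> R) : v =1 w -> h R v = h R w.
  by move=> /funext ->.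
(* The first [k] variables are freed from the grid one at a time, each time by
   counting roots of a polynomial over a domain of characteristic 0. *)
have hybrid (k : nat) (R : idomainType) (v : 'I_N -> R) :
    (forall m : nat, m.+1%:R != 0 :> R) -> (k <= N)%N ->
    (forall i : 'I_N, (k <= i)%N -> exists a : 'I_D.+1, v i = a%:R) -> h R v = 0.
  move=> charR; elim: k v => [|k IHk] v kN va.
    have /fin_all_exists[a vE] (i : 'I_N) : exists a : 'I_D.+1, v i = a%:R.
      exact: va.
    have := hnat _ R intr (fun i => (finfun a i)%:R).
    rewrite h0 rmorph0 => ->; apply: hext => i.
    by rewrite vE ffunE /= natz -pmulrn.
  pose i0 := Ordinal kN.
  pose w x := fun j => if j == i0 then x else v j.
  pose P : {poly R} := h _ (fun j => if j == i0 then 'X else (v j)%:P).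
  have PE x : P.[x] = h R (w x).
    rewrite -[P.[x]]/(horner_eval x P) (hnat _ _ (horner_eval x)).
    apply: hext => j; rewrite /w.
    by case: eqP => _; rewrite /= horner_evalE ?hornerX ?hornerC.
  have P0 : P = 0.
    apply/eqP; apply: contraTT (hdeg R v i0) => P_neq0; rewrite -ltnNge.
    have := @max_poly_roots R P [seq a%:R | a : 'I_D.+1 <- enum 'I_D.+1] P_neq0.
    rewrite size_map -cardE card_ord; apply.
      apply/allP => _ /mapP[a _ ->]; rewrite /root PE; apply/eqP/IHk.
        exact: ltnW.
      move=> i ki; rewrite /w; case: eqP => [_|/eqP ni]; first by exists a.
      by apply: va; rewrite ltn_neqAle ki andbT; apply: contraNneq ni => kE;
         apply/eqP/val_inj.
    rewrite map_inj_uniq ?enum_uniq // => a b /eqP.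
    wlog ab : a b / (a <= b)%N.
      by move=> H; case: (leqP a b) => [|/ltnW] ab E; [|symmetry]; apply: H => //; rewrite eq_sym.
    rewrite eq_sym -subr_eq0 -natrB // => E; apply/val_inj/eqP; rewrite eqn_leq ab /=.
    by rewrite -subn_eq0; case: (b - a)%N E => // m; rewrite (negPf (charR m)).
  have := PE (v i0); rewrite P0 horner0 => ->; apply: hext => j.
  by rewrite /w; case: eqP => // ->.
(* The generic point of [{mpoly int[N]}] specialises to any [u] in any field. *)
pose R := mpoly N int.
have charR m : m.+1%:R != 0 :> R.
  by rewrite -mpolyC_nat mpolyC_eq0 pnatr_eq0.
have := hybrid N _ (fun i => mpolyX int (mnm1 i)) charR (leqnn _).
have vac (i : 'I_N) : (N <= i)%N -> exists a : 'I_D.+1, mpolyX int (mnm1 i) = a%:R.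
  by rewrite leqNgt ltn_ord.
move=> /(_ vac) /(congr1 (mmap intr u)).
rewrite raddf0 (hnat _ _ (mmap intr u)) => <-; apply: hext => i.
by rewrite /= mmapX mmap1U.
Qed.

(** The table of variables stays fixed while the ring varies, with [None] for a zero entry, so its
    determinants form a family to which [grid_vanishing] applies. *)
Definition var_mx (R : comNzRingType) (N q : nat) (E : 'M[option 'I_N]_q)
    (v : 'I_N -> R) : 'M[R]_q :=
  map_mx (oapp v 0) E.

Lemma rmorph_det_var_mx (R S : comNzRingType) (phi : {rmorphism R -> S}) (N q : nat)
    (E : 'M[option 'I_N]_q) (v : 'I_N -> R) :
  phi (\det (var_mx E v)) = \det (var_mx E (fun i => phi (v i))).
Proof.
rewrite -det_map_mx; congr (\det _); apply/matrixP => a b; rewrite !mxE.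
by case: (E a b) => [i|] //=; rewrite rmorph0.
Qed.

Lemma size_det_var_mx (R : idomainType) (N q : nat) (E : 'M[option 'I_N]_q)
    (v : 'I_N -> {poly R}) :
  (forall i, (size (v i) <= 2)%N) -> (size (\det (var_mx E v)) <= q.+1)%N.
Proof.
move=> sv; apply: (leq_trans (size_sum _ _ _)); apply/bigmax_leqP => s _.
rewrite mulr_sign; case: ifP => _; rewrite ?size_polyN;
  apply: (leq_trans (size_poly_prod_leq _ _));
  rewrite leq_subLR card_ord addnS ltnS;
  rewrite addnn -mul2n mulnC -[X in (_ <= X * _)%N]card_ord -sum_nat_const;
  apply: leq_sum => a _; rewrite mxE; case: (E _ _) => //=; by rewrite size_poly0.
Qed.

Lemma norm_det_var_mx (N q D : nat) (E : 'M[option 'I_N]_q) (v : 'I_N -> int) :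
  (forall i, `|v i| <= D%:R) -> `|\det (var_mx E v)| <= (q`! * D ^ q)%:R.
Proof.
move=> vD; apply: (le_trans (ler_norm_sum _ _ _)).
rewrite natrM -{1}(perm.card_Sn q) -sum1_card natr_sum mulr_suml.
apply: ler_sum => s _; rewrite mul1r normrM normr_sign mul1r normr_prod natrX.
rewrite -[X in _ ^+ X]card_ord -prodr_const; apply: ler_prod => a _.
rewrite normr_ge0 mxE; by case: (E _ _) => [i|] //=.
Qed.

Definition zero_pattern (J : finType) (N q : nat) (E : J -> 'M[option 'I_N]_q)
    (S : {set J}) : Prop :=
  exists (F : fieldType) (v : 'I_N -> F), S = [set j | \det (var_mx (E j) v) != 0].

(** The shift by [L] codes the integers between [-L] and [L] injectively in a finite ordinal, for
    the pigeonhole argument below. *)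
Lemma absz_shift_lt (x : int) (L : nat) :
  `|x| <= L%:R -> (absz (x + L%:R)%R < (2 * L).+1)%N.
Proof. by rewrite natz; lia. Qed.

Lemma absz_shift_inj (x y : int) (L : nat) :
  `|x| <= L%:R -> `|y| <= L%:R -> absz (x + L%:R) = absz (y + L%:R) -> x = y.
Proof. by rewrite natz; lia. Qed.

Lemma card_zero_patterns (J : finType) (N q : nat) (E : J -> 'M[option 'I_N]_q)
    (P : {set {set J}}) :
  let D := (#|J| * q)%N in
  (forall S, S \in P -> zero_pattern E S) ->
  (2 ^ #|P| <= (2 ^ #|J|.+2 * (q`! * D.+1 ^ q) ^ #|J|) ^ (D.+1 ^ N))%N.
Proof.
move=> D Ppat.
pose g (S : {set J}) (R : comNzRingType) (v : 'I_N -> R) :=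
  \prod_(j in S) \det (var_mx (E j) v).
pose b := (q`! * D.+1 ^ q)%N.
have b_gt0 : (0 < b)%N by rewrite muln_gt0 fact_gt0 expn_gt0.
(* At most [2 ^ #|J|] patterns, each with at most [#|J|] factors of absolute value at most [b] on
   the grid. *)
pose L := (2 ^ #|J| * b ^ #|J|)%N.
pose gsum (X : {set {set J}}) (R : comNzRingType) v := \sum_(S in X) g S R v.
pose pt (a : {ffun 'I_N -> 'I_D.+1}) : 'I_N -> int := fun i => (a i)%:R.
have gsum_le X a : `|gsum X _ (pt a)| <= L%:R.
  apply: (le_trans (ler_norm_sum _ _ _)).
  apply: (@le_trans _ _ (\sum_(S in X) (b ^ #|J|)%:R)).
    apply: ler_sum => S _; rewrite normr_prod.
    apply: (@le_trans _ _ (\prod_(j in S) b%:R)).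
      apply: ler_prod => j _; rewrite normr_ge0 /=.
      apply: norm_det_var_mx => i; rewrite /pt normr_nat ler_nat.
      exact: ltnW.
    by rewrite prodr_const -natrX ler_nat leq_pexp2l // max_card.
  rewrite sumr_const -mulrnA ler_nat /L mulnC leq_mul2r.
  by rewrite -[J in (2 ^ J)%N]cardsT -card_powerset powersetT cardsT max_card orbT.
pose Phi X := [ffun a => (inord (absz (gsum X int (pt a) + L%:R)%R) : 'I_(2 * L).+1)].
rewrite leqNgt; apply/negP => big.
have /dinjectivePn[X XP [Y /andP[YX YP] PhiE]] : ~~ dinjectiveb Phi (mem (powerset P)).
  apply: contraTN big => /dinjectiveP /card_in_imset; rewrite card_powerset -leqNgt => <-.
  apply: (leq_trans (max_card _)); rewrite !card_ffun !card_ord.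
  rewrite leq_exp2r ?expn_gt0 //.
  (* A table entry takes [2 * L + 1] values, at most [4 * L]; hence the exponent [#|J|.+2]. *)
  have L_gt0 : (0 < L)%N by rewrite muln_gt0 !expn_gt0 b_gt0.
  rewrite !expnS -!mulnA -/b -/L; lia.
pose h (R : comNzRingType) (v : 'I_N -> R) : R := gsum X R v - gsum Y R v.
have h0 (F : fieldType) (u : 'I_N -> F) : h F u = 0.
  apply: (@grid_vanishing N D h).
  - move=> R S phi v; rewrite /h rmorphB /gsum !rmorph_sum.
    by congr (_ - _); apply: eq_bigr => T _; rewrite /g rmorph_prod;
       apply: eq_bigr => j _; rewrite rmorph_det_var_mx.
  - move=> R v i; apply: (leq_trans (size_polyD _ _)); rewrite size_polyN geq_max.
    have gD Z : (size (gsum Z {poly R} (fun j => if j == i then 'X else (v j)%:P)) <= D.+1)%N.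
      apply: (leq_trans (size_sum _ _ _)); apply/bigmax_leqP => T _.
      apply: (leq_trans (size_poly_prod_leq _ _)).
      rewrite leq_subLR addnS ltnS.
      apply: (@leq_trans (\sum_(j in T) q.+1)).
        apply: leq_sum => j _; apply: size_det_var_mx => k.
        by case: ifP => _; rewrite ?size_polyX // (leq_trans (size_polyC_leq1 _)).
      by rewrite sum_nat_const mulnS leq_add2l leq_mul2r max_card orbT.
    by rewrite !gD.
  - move=> a; move/ffunP: PhiE => /(_ a); rewrite !ffunE => /(congr1 val).
    have ub Z := absz_shift_lt (gsum_le Z a).
    rewrite /= !inordK // => E12; apply/eqP; rewrite subr_eq0; apply/eqP.
    exact: absz_shift_inj (gsum_le X a) (gsum_le Y a) E12.
pose Q := (X :\: Y) :|: (Y :\: X).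
have [S0 S0Q] : exists S, S \in Q.
  apply/set0Pn; apply: contraNneq YX => Q0; apply/eqP/setP => S.
  by have := in_set0 S; rewrite -Q0 !inE; case: (S \in X); case: (S \in Y).
pose S1 := [arg min_(S < S0 in Q) #|S|].
have [S1Q S1min] : S1 \in Q /\ forall S, S \in Q -> (#|S1| <= #|S|)%N.
  by rewrite /S1; case: arg_minnP.
have [F [v S1E]] : zero_pattern E S1.
  apply: Ppat; move: S1Q XP YP; rewrite !inE => /orP[] /andP[_ S1X] /subsetP H1 /subsetP H2; by auto.
(* At a witness of [S1] the nonzero determinants are exactly those indexed by [S1], so [g S]
   survives only for subsets of [S1]. By minimality [S1] is the only such set in [Q]. *)
have gE S : (g S F v != 0) = (S \subset S1).
  apply/prodf_neq0/subsetP => H j jS; first by rewrite S1E inE H.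
  by have := H j jS; rewrite S1E inE.
have := h0 F v.
have -> : h F v = \sum_(S in Q) ((S \in X)%:R - (S \in Y)%:R) * g S F v.
  rewrite /h /gsum !(big_mkcond (fun S => S \in X)) !(big_mkcond (fun S => S \in Y)).
  rewrite (big_mkcond (fun S => S \in Q)) -sumrB; apply: eq_bigr => S _.
  by rewrite !inE; case: (S \in X); case: (S \in Y) => //=; rewrite ?subrr ?subr0 ?sub0r ?mul1r ?mulN1r.
rewrite (bigD1 S1) //= big1 => [|S /andP[SQ SS1]].
  rewrite addr0 => /eqP; rewrite mulf_eq0 (negPf (_ : g S1 F v != 0)) ?gE // orbF.
  by move: S1Q; rewrite !inE; case: (_ \in X); case: (_ \in Y); rewrite //= ?subr0 ?sub0r ?oppr_eq0 oner_eq0.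
apply/eqP; rewrite mulf_eq0; apply/orP; right; apply/negPn; rewrite gE.
apply: contra SS1 => SS1. by rewrite eqEcard SS1 S1min.
Qed.

(** * Supports of matrices with sparse bases *)

Definition slot (n t : nat) (gamma : 'I_t -> 'I_n * 'I_n) (z : 'I_n * 'I_n) : option 'I_t :=
  [pick k | gamma k == z].

(* Evaluated at the entries of a matrix [M] listed by [gamma], its determinant is
   [- \det B * M i j] where [B] is the submatrix of [M] on the row basis [alpha]
   and the column basis [beta]; see [det_bordered]. *)
Definition code_mx (n r t : nat) (alpha beta : 'I_r -> 'I_n)
    (gamma : 'I_t -> 'I_n * 'I_n) (ij : 'I_n * 'I_n) : 'M[option 'I_t]_(r + 1) :=
  block_mx (\matrix_(a, b) slot gamma (alpha a, beta b))
           (\matrix_(a, _) slot gamma (alpha a, ij.2))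
           (\matrix_(_, b) slot gamma (ij.1, beta b))
           (const_mx None).

Definition sparse_patterns (n r t : nat) : {set {set 'I_n * 'I_n}} :=
  [set Z | `[< exists (alpha beta : 'I_r -> 'I_n) (gamma : 'I_t -> 'I_n * 'I_n),
               zero_pattern (code_mx alpha beta gamma) Z >]].

(** Exponents of 2 are compared in [card_zero_patterns]. With [n * n] determinants, [D.+1] is at
    most [n ^ 5] and the base of the outer power is at most [2 ^ (n ^ 9)]; as [t] is positive,
    [n ^ 9 * n ^ (5 * t)] is at most [n ^ (14 * t)]. *)
Lemma zero_pattern_bound (n t q : nat) (E : 'I_n * 'I_n -> 'M[option 'I_t]_q)
    (P : {set {set 'I_n * 'I_n}}) :
  (2 <= n)%N -> (0 < t)%N -> (q <= n.+1)%N ->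
  (forall Z, Z \in P -> zero_pattern E Z) -> (#|P| <= n ^ (14 * t))%N.
Proof.
move=> n2 t0 qn /card_zero_patterns; rewrite card_prod card_ord.
have n0 : (0 < n)%N by apply: leq_trans n2.
have nX e e' : (e <= e')%N -> (n ^ e <= n ^ e')%N by move=> ?; rewrite leq_pexp2l.
have n1 : (n.+1 <= n ^ 2)%N by rewrite expnS expn1; nia.
have D5 : ((n * n * q).+1 <= n ^ 5)%N.
  apply: (@leq_trans (n * n * n.+1).+1); first by rewrite ltnS leq_mul2l qn orbT.
  by rewrite !expnS expn0 muln1; nia.
have qq : (q`! <= n ^ (2 * q))%N.
  rewrite expnM; apply: (@leq_trans (q ^ q)).
    rewrite -ffactnn ffact_prod -[X in (_ <= _ ^ X)%N]card_ord -prod_nat_const.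
    by apply: leq_prod => i _; rewrite leq_subr.
  by case: (q) qn => // q' qn; rewrite leq_exp2r // (leq_trans qn).
have b7 : (q`! * (n * n * q).+1 ^ q <= 2 ^ (7 * q * n))%N.
  apply: (@leq_trans (n ^ (7 * q))).
    rewrite (_ : 7 * q = 2 * q + 5 * q)%N; last lia.
    rewrite expnD leq_mul // expnM; case: (q) D5 => // q' D5.
    by rewrite leq_exp2r.
  rewrite [(7 * q * n)%N]mulnC (expnM 2); case: (q) => [|q'] //.
  by rewrite leq_exp2r // ltnW // ltn_expl.
move=> H; have {H} : (2 ^ #|P| <= 2 ^ (n ^ 9 * n ^ (5 * t)))%N.
  apply: (leq_trans H).
  rewrite (expnM 2) (expnM n).
  apply: (@leq_trans ((2 ^ n ^ 9) ^ ((n * n * q).+1 ^ t))); last first.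
    by rewrite leq_exp2l ?leq_exp2r // -{1}(expn0 2) ltn_exp2l // expn_gt0 n0.
  rewrite leq_exp2r ?expn_gt0 //.
  apply: (@leq_trans (2 ^ (n * n).+2 * 2 ^ (7 * q * n * (n * n)))).
    by rewrite leq_mul2l [(2 ^ (_ * (n * n)))%N]expnM leq_exp2r ?b7 ?orbT // muln_gt0 n0.
  rewrite -expnD leq_exp2l //.
  (* With [x = n ^ 3] the sum is at most [8 * (x * x)], and [x] is at least 8. *)
  apply: (@leq_trans ((n * n).+2 + 7 * n.+1 * n * (n * n))).
    by rewrite leq_add2l !leq_mul.
  have : (8 <= n ^ 3)%N by rewrite -[8%N]/(2 ^ 3)%N leq_exp2r.
  have : (n * n.+1 <= n ^ 3)%N by rewrite expnS leq_mul2l n1 orbT.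
  have -> : (n ^ 9 = n ^ 3 * n ^ 3 * n ^ 3)%N by rewrite -!expnD.
  have : (1 < n * n)%N by nia.
  have : (n * n <= n ^ 3)%N by rewrite -[(n * n)%N]/(n ^ 2)%N nX.
  move: (n ^ 3)%N (n * n)%N => x y yx y1 nx x8.
  apply: (@leq_trans (8 * (x * x))); last by rewrite -mulnA leq_mul2r x8 orbT.
  apply: (@leq_trans (x * x + 7 * (x * x))); last by lia.
  apply: leq_add; first by nia.
  by rewrite -!mulnA leq_mul2l /= mulnA leq_mul // mulnC.
rewrite leq_exp2l // -expnD => /leq_trans; apply; apply: nX; lia.
Qed.

Lemma leq_card_bigcup (I T : finType) (B : I -> {set T}) :
  (#|\bigcup_i B i| <= \sum_i #|B i|)%N.
Proof.
elim/big_rec2: _ => [|i m A _ IH]; first by rewrite cards0.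
by apply: (leq_trans (leq_card_setU _ _)); rewrite leq_add2l.
Qed.

(** As [r <= t], there are at most [n ^ (4 * t)] choices of [alpha], [beta] and [gamma], each giving
    at most [n ^ (14 * t)] patterns. *)
Lemma card_sparse_patterns (n r t : nat) :
  (2 <= n)%N -> (0 < t)%N -> (r <= t)%N -> (r <= n)%N ->
  (#|sparse_patterns n r t| <= n ^ (18 * t))%N.
Proof.
move=> n2 t0 rt rn.
pose code := ({ffun 'I_r -> 'I_n} * {ffun 'I_r -> 'I_n} * {ffun 'I_t -> 'I_n * 'I_n})%type.
pose P (c : code) := [set Z | `[< zero_pattern (code_mx c.1.1 c.1.2 c.2) Z >]].
have sub : sparse_patterns n r t \subset \bigcup_(c : code) P c.
  apply/subsetP => Z; rewrite inE => /asboolP[alpha [beta [gamma Zpat]]].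
  apply/bigcupP; exists (finfun alpha, finfun beta, finfun gamma) => //.
  rewrite inE; apply/asboolP => /=.
  suff -> : code_mx (finfun alpha) (finfun beta) (finfun gamma) = code_mx alpha beta gamma by [].
  by rewrite !(funext (ffunE _)).
apply: (leq_trans (subset_leq_card sub)); apply: (leq_trans (leq_card_bigcup _)) => /=.
apply: (@leq_trans (\sum_(c : code) n ^ (14 * t))).
  apply: leq_sum => c _.
  apply: (zero_pattern_bound (E := code_mx c.1.1 c.1.2 c.2)) => //; last first.
    by move=> Z; rewrite inE => /asboolP.
  by rewrite addn1 ltnS.
rewrite sum_nat_const !card_prod !card_ffun card_prod !card_ord.
rewrite -[(n * n)%N]/(n ^ 2)%N -expnM -!expnD leq_pexp2l //; [exact: leq_trans n2 | lia].
Qed.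

Lemma det_bordered (F : fieldType) (r : nat) (B : 'M[F]_r) (x : 'cV[F]_r) (y : 'rV[F]_r) :
  B \in unitmx -> \det (block_mx B x y 0) = - (\det B * (y *m invmx B *m x) 0 0).
Proof.
move=> Bu.
have -> : block_mx B x y 0 =
    block_mx B 0 y 1%:M *m block_mx 1%:M (invmx B *m x) 0 (- (y *m invmx B *m x)).
  rewrite mulmx_block !mulmx1 !mulmx0 !mul0mx !mul1mx !addr0 mulmxA.
  by rewrite mulmxV // mul1mx mulmxA subrr.
by rewrite det_mulmx det_lblock det_ublock !det1 mulr1 mul1r det_mx11 mxE mulrN.
Qed.

Definition mxsupp (F : fieldType) (n : nat) (A : 'M[F]_n) : {set 'I_n * 'I_n} :=
  [set ij | A ij.1 ij.2 != 0].

Definition cross_supp (F : fieldType) (n : nat) (A : 'M[F]_n) (B1 B2 : {set 'I_n}) :=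
  [set ij in mxsupp A | (ij.1 \in B1) || (ij.2 \in B2)].

(** The block [B] on a row basis and a column basis is invertible, and [A] equals
    [Cl *m invmx B *m Rw]. So the bordered determinant at a position vanishes exactly when [A] does
    there, while apart from its zero corner it only uses entries in basis rows or columns, of which
    only the nonzero ones need variables. *)
Lemma support_sparse_pattern (F : fieldType) (n r : nat) (A : 'M[F]_n) (B1 B2 : {set 'I_n}) :
  \rank A = r -> #|B1| = r -> #|B2| = r ->
  (A <= rowsub (fun a : 'I_#|B1| => enum_val a) A)%MS ->
  (A^T <= rowsub (fun a : 'I_#|B2| => enum_val a) A^T)%MS ->
  mxsupp A \in sparse_patterns n r #|cross_supp A B1 B2|.
Proof.
move=> rA rB1 rB2 spanR spanC; set T := cross_supp A B1 B2.
rewrite inE; apply/asboolP.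
pose alpha (a : 'I_r) : 'I_n := enum_val (cast_ord (esym rB1) a).
pose beta (a : 'I_r) : 'I_n := enum_val (cast_ord (esym rB2) a).
pose gamma (k : 'I_#|T|) := enum_val k.
exists alpha, beta, gamma, F, (fun k => A (gamma k).1 (gamma k).2).
pose Rw := rowsub alpha A; pose Cl := colsub beta A.
pose B := mxsub alpha beta A.
have {}spanR : (A <= Rw)%MS.
  apply: (submx_trans spanR); apply/row_subP => a.
  rewrite (_ : row a _ = row (cast_ord rB1 a) Rw) ?row_sub //.
  by apply/rowP => j; rewrite !mxE /alpha cast_ordK.
have {}spanC : (A^T <= Cl^T)%MS.
  apply: (submx_trans spanC); apply/row_subP => a.
  rewrite (_ : row a _ = row (cast_ord rB2 a) Cl^T) ?row_sub //.
  by apply/rowP => j; rewrite !mxE /beta cast_ordK.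
have [X AX] := submxP spanR.
have ClE : Cl = X *m B.
  by apply/matrixP => i b; rewrite !mxE AX !mxE; apply: eq_bigr => k _; rewrite !mxE.
(* [Cl] has rank [r] because its columns span those of [A], and it factors through [B]. *)
have Bu : B \in unitmx.
  rewrite -row_full_unit /row_full eqn_leq rank_leq_col /=.
  apply: (@leq_trans (\rank Cl)); last by rewrite ClE mxrankM_maxr.
  by rewrite -(mxrank_tr Cl) -[X in (X <= _)%N]rA -(mxrank_tr A) mxrankS.
have XE : X = Cl *m invmx B by rewrite ClE mulmxK.
(* Positions of the cross omitted by [gamma] hold zeros of [A], matching the default value of
   [None]. *)
have slotE (i j : 'I_n) : (i \in B1) || (j \in B2) ->
    oapp (fun k => A (gamma k).1 (gamma k).2) 0 (slot gamma (i, j)) = A i j.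
  move=> ijB; rewrite /slot; case: pickP => [k /eqP /= ->|noT] //=.
  apply/esym/eqP; apply: contraTT isT => Aij.
  have ijT : (i, j) \in T by rewrite !inE Aij.
  by have := noT (enum_rank_in ijT (i, j)); rewrite /gamma enum_rankK_in // eqxx.
have alphaB a : alpha a \in B1 by rewrite enum_valP.
have betaB a : beta a \in B2 by rewrite enum_valP.
apply/setP => -[i j]; rewrite !inE /=.
have -> : var_mx (code_mx alpha beta gamma (i, j)) (fun k => A (gamma k).1 (gamma k).2) =
    block_mx B (col j Rw) (row i Cl) 0.
  rewrite /var_mx /code_mx map_block_mx; congr block_mx; apply/matrixP => a b;
    by rewrite !mxE ?slotE //= ?alphaB ?betaB ?orbT.
rewrite det_bordered // oppr_eq0 mulf_eq0.
have -> : (row i Cl *m invmx B *m col j Rw) 0 0 = A i j.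
  by rewrite -row_mul -XE AX !mxE; apply: eq_bigr => k _; rewrite !mxE.
by rewrite (negPf (_ : \det B != 0)) // -unitfE -unitmxE.
Qed.

(** * Sparse bases *)

(** Rows outside [W] are zeroed rather than deleted, so that row selections of all sizes share one
    type. *)
Definition mask_mx (F : fieldType) (n : nat) (W : {set 'I_n}) : 'M[F]_n :=
  diag_mx (\row_i (i \in W)%:R).
Arguments mask_mx F {n} W.

Lemma mask_mxE (F : fieldType) (n p : nat) (W : {set 'I_n}) (A : 'M[F]_(n, p)) i j :
  (mask_mx F W *m A) i j = (i \in W)%:R * A i j.
Proof. by rewrite mul_diag_mx !mxE. Qed.

Lemma row_mask_mx (F : fieldType) (n p : nat) (W : {set 'I_n}) (A : 'M[F]_(n, p)) i :
  row i (mask_mx F W *m A) = (i \in W)%:R *: row i A.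
Proof. by apply/rowP => j; rewrite mxE mask_mxE !mxE. Qed.

Lemma mask_mx_sub (F : fieldType) (n p q : nat) (W : {set 'I_n}) (A : 'M[F]_(n, p))
    (X : 'M[F]_(q, p)) :
  reflect (forall i, i \in W -> (row i A <= X)%MS) (mask_mx F W *m A <= X)%MS.
Proof.
apply: (iffP row_subP) => H i; last first.
  by rewrite row_mask_mx; have [/H|_] := boolP (i \in W); rewrite ?scale1r ?scale0r ?sub0mx.
by move=> iW; have := H i; rewrite row_mask_mx iW scale1r.
Qed.

Lemma row_sub_mask_mx (F : fieldType) (n p : nat) (W : {set 'I_n}) (A : 'M[F]_(n, p)) i :
  i \in W -> (row i A <= mask_mx F W *m A)%MS.
Proof. by move: i; apply/mask_mx_sub. Qed.

Lemma mask_mxI (F : fieldType) (n : nat) (W U : {set 'I_n}) :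
  mask_mx F (W :&: U) = mask_mx F W *m mask_mx F U.
Proof.
apply/matrixP => i j; rewrite mask_mxE !mxE inE; case: eqP => [->|_].
  by rewrite !mulr1n -natrM mulnb.
by rewrite !mulr0n mulr0.
Qed.

Lemma tr_mask_mx (F : fieldType) (n : nat) (W : {set 'I_n}) : (mask_mx F W)^T = mask_mx F W.
Proof. exact: tr_diag_mx. Qed.

(* The rows kept are those outside the span of the rows preceding them when the
   rows are sorted by weight. *)
Lemma greedy_row_basis (F : fieldType) (n p : nat) (A : 'M[F]_(n, p)) (w : 'I_n -> nat) :
  exists B : {set 'I_n},
    [/\ #|B| = \rank A, (A <= mask_mx F B *m A)%MS &
        forall tau, #|[set i in B | (w i <= tau)%N]| =
                    \rank (mask_mx F [set i | (w i <= tau)%N] *m A)].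
Proof.
(* Ties in weight are broken by index: with distinct keys the rows enter one at a time, each raising
   the rank by at most one. *)
pose key (i : 'I_n) := (w i * n + i)%N.
have key_inj : injective key.
  move=> i j /(congr1 (modn^~ n)); rewrite /key !modnMDl !modn_small //.
  exact: val_inj.
pose pre k := [set i | (key i < k)%N].
pose B := [set i | ~~ (row i A <= mask_mx F (pre (key i)) *m A)%MS].
have main k : #|B :&: pre k| = \rank (mask_mx F (pre k) *m A) /\
    (mask_mx F (pre k) *m A <= mask_mx F (B :&: pre k) *m A)%MS.
  elim: k => [|k [IHc IHs]].
    have -> : pre 0%N = set0 by apply/setP => i; rewrite !inE.
    have -> : mask_mx F (set0 : {set 'I_n}) *m A = 0.
      by apply/matrixP => i j; rewrite mask_mxE inE mul0r mxE.
    by rewrite setI0 cards0 mxrank0 sub0mx.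
  have [/existsP[i /eqP ik]|noi] := boolP [exists i, key i == k]; last first.
    suff -> : pre k.+1 = pre k by [].
    apply/setP => i; rewrite !inE ltnS leq_eqVlt.
    by case: eqP => // ik; case/existsP: noi; exists i; apply/eqP.
  have preS : pre k.+1 = i |: pre k.
    apply/setP => j; rewrite !inE ltnS leq_eqVlt; congr (_ || _).
    by rewrite -ik (inj_eq key_inj).
  have iNk : i \notin pre k by rewrite inE ik ltnn.
  have preE : (mask_mx F (pre k.+1) *m A :=: mask_mx F (pre k) *m A + row i A)%MS.
    apply/eqmxP/andP; split.
      apply/mask_mx_sub => j; rewrite preS !inE => /orP[/eqP ->|jk].
        exact: addsmxSr.
      by apply: submx_trans (addsmxSl _ _); apply: row_sub_mask_mx; rewrite inE.
    rewrite addsmx_sub; apply/andP; split.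
      by apply/mask_mx_sub => j jk; apply: row_sub_mask_mx; rewrite preS inE jk orbT.
    by apply: row_sub_mask_mx; rewrite preS !inE eqxx.
  have BS : B :&: pre k \subset B :&: pre k.+1.
    by apply: setIS; rewrite preS subsetUr.
  have maskS (V W : {set 'I_n}) : V \subset W -> (mask_mx F V *m A <= mask_mx F W *m A)%MS.
    by move=> /subsetP VW; apply/mask_mx_sub => j /VW; apply: row_sub_mask_mx.
  have [iB|] := boolP (i \in B); last first.
    move=> iNB; have := iNB; rewrite inE negbK ik => iA.
    have -> : B :&: pre k.+1 = B :&: pre k.
      apply/setP => j; rewrite preS !in_setI in_setU1.
      by case: (eqVneq j i) => [->|//]; rewrite (negPf iNB).
    have eqA : (mask_mx F (pre k.+1) *m A :=: mask_mx F (pre k) *m A)%MS.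
      by apply: (eqmx_trans preE); apply/addsmx_idPl.
    by rewrite IHc !eqA.
  have BE : B :&: pre k.+1 = i |: (B :&: pre k).
    by rewrite preS setIUr; congr (_ :|: _); apply/setIidPr; rewrite sub1set.
  split.
    rewrite BE cardsU1 in_setI (negPf iNk) andbF IHc add1n preE.
    apply/eqP; rewrite eqn_leq; apply/andP; split.
      apply: rank_ltmx; rewrite ltmxE addsmxSl /=; apply/negP => H.
      move: iB; rewrite inE ik => /negP; apply.
      by apply: submx_trans H; apply: addsmxSr.
    apply: (leq_trans (mxrank_adds_leqif _ _)); rewrite -[X in (_ <= X)%N]addn1 leq_add2l.
    exact: rank_leq_row.
  rewrite preE addsmx_sub; apply/andP; split.
    by apply: (submx_trans IHs); apply: maskS.
  by apply: row_sub_mask_mx; rewrite BE !inE eqxx.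
(* Since [i < n], a key below [tau.+1 * n] means a weight at most [tau]. *)
have preT tau : pre (tau.+1 * n)%N = [set i | (w i <= tau)%N].
  apply/setP => i; rewrite !inE /key; have := ltn_ord i.
  by move=> iN; apply/idP/idP; nia.
have all_pre : pre ((\max_i w i).+1 * n)%N = setT.
  by rewrite preT; apply/setP => i; rewrite !inE leq_bigmax.
have maskT : mask_mx F [set: 'I_n] *m A = A.
  by apply/matrixP => i j; rewrite mask_mxE inE mul1r.
exists B; split.
- by have [] := main ((\max_i w i).+1 * n)%N; rewrite all_pre setIT maskT.
- by have [] := main ((\max_i w i).+1 * n)%N; rewrite all_pre setIT maskT.
move=> tau; rewrite -preT; have [<- _] := main (tau.+1 * n)%N; rewrite preT.
by apply: eq_card => i; rewrite !inE.
Qed.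

(** Layer-cake summation: a weight is the number of thresholds below it, and the hypotheses are
    added over all thresholds. *)
Lemma sum_layers (I : finType) (B : {set I}) (w : I -> nat) (m r : nat) :
  (forall tau, m * #|[set i in B | (tau < w i)%N]| <= r * #|[set i | (tau < w i)%N]|)%N ->
  (m * \sum_(i in B) w i <= r * \sum_i w i)%N.
Proof.
move=> H; pose h := \max_i w i.
have wE i : w i = (\sum_(tau < h) (tau < w i))%N.
  rewrite -(big_mkord xpredT (fun tau => nat_of_bool (tau < w i)%N)) (big_cat_nat _ (n := w i)) ?leq_bigmax //=.
  rewrite [X in (_ + X)%N]big_nat_cond [X in (_ + X)%N]big1 => [|j]; last first.
    by rewrite andbT => /andP[ij _]; rewrite ltnNge ij.
  rewrite addn0 big_nat_cond (eq_bigr (fun _ => 1%N)) => [|j]; last first.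
    by rewrite andbT => /andP[_ ->].
  by rewrite -big_nat_cond sum_nat_const_nat subn0 muln1.
have sE (V : {set I}) : (\sum_(i in V) w i = \sum_(tau < h) #|[set i in V | (tau < w i)%N]|)%N.
  rewrite (eq_bigr _ (fun i _ => wE i)) exchange_big /=; apply: eq_bigr => tau _.
  rewrite -sum1dep_card [RHS]big_mkcondr /=.
  by apply: eq_bigr => i _; case: ifP.
have -> : (\sum_i w i = \sum_(i in setT) w i)%N by apply: eq_bigl => i; rewrite inE.
rewrite !sE !big_distrr /=; apply: leq_sum => tau _; apply: (leq_trans (H _)).
by rewrite leq_mul2l; apply/orP; right; apply: subset_leq_card; apply/subsetP => i; rewrite !inE.
Qed.

Definition masked_mx (F : fieldType) (n : nat) (M : 'M[F]_n) (U : {set 'I_n}) : 'M[F]_n :=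
  mask_mx F U *m M *m mask_mx F U.

Lemma masked_mxE (F : fieldType) (n : nat) (M : 'M[F]_n) (U : {set 'I_n}) i j :
  masked_mx M U i j = (i \in U)%:R * M i j * (j \in U)%:R.
Proof. by rewrite /masked_mx mul_mx_diag mxE mask_mxE mxE. Qed.

Lemma rank_masked_mx_le (F : fieldType) (n : nat) (M : 'M[F]_n) (U W : {set 'I_n}) :
  (\rank (masked_mx M (W :&: U)) <= \rank (mask_mx F W *m masked_mx M U))%N.
Proof.
rewrite /masked_mx {2}setIC !mask_mxI !mulmxA; exact: mxrankM_maxl.
Qed.

Lemma tr_masked_mx (F : fieldType) (n : nat) (M : 'M[F]_n) (U : {set 'I_n}) :
  (masked_mx M U)^T = masked_mx M^T U.
Proof. by rewrite /masked_mx !trmx_mul !tr_mask_mx mulmxA. Qed.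

(** [U] minimises the ratio of rank to size; denominators are cleared so that the empty set needs no
    exception. *)
Definition balanced (F : fieldType) (n : nat) (M : 'M[F]_n) (U : {set 'I_n}) : Prop :=
  forall W : {set 'I_n},
    (\rank (masked_mx M U) * #|W| <= #|U| * \rank (masked_mx M W))%N.

Lemma balanced_tr (F : fieldType) (n : nat) (M : 'M[F]_n) (U : {set 'I_n}) :
  balanced M U -> balanced M^T U.
Proof. by move=> H W; rewrite -!tr_masked_mx !mxrank_tr. Qed.

Lemma exists_balanced (F : fieldType) (n : nat) (M : 'M[F]_n) :
  (0 < n)%N -> exists2 U : {set 'I_n}, (0 < #|U|)%N & balanced M U.
Proof.
move=> n_gt0; pose ratio (U : {set 'I_n}) : rat := (\rank (masked_mx M U))%:R / #|U|%:R.
have T0 : (0 < #|[set: 'I_n]|)%N by rewrite cardsT card_ord.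
case: (@Order.TotalTheory.arg_minP _ _ _ [set: 'I_n] (fun U => 0 < #|U|)%N ratio T0) => U U0 Umin.
exists U => // W; have [->|W0] := posnP #|W|; first by rewrite muln0.
have := Umin W W0; rewrite /ratio ler_pdivrMr ?ltr0n // mulrAC ler_pdivlMr ?ltr0n //.
by rewrite -!natrM ler_nat [(#|U| * _)%N]mulnC.
Qed.

Lemma card_set_rows (I J : finType) (S : {set I * J}) (B : {set I}) :
  #|[set ij in S | ij.1 \in B]| = (\sum_(i in B) #|[set j | (i, j) \in S]|)%N.
Proof.
under eq_bigr do rewrite -sum1dep_card.
rewrite pair_big_dep -sum1dep_card; apply: eq_bigl => -[i j] /=.
by rewrite andbC.
Qed.

(** Rows are weighed by their number of nonzero entries. At each threshold, balance bounds the rank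
    of the light rows from below, and the greedy basis contains that many light rows. So it takes at
    most a fraction [\rank A / #|U|] of the heavy rows, and [sum_layers] adds up the thresholds. *)
Lemma sparse_row_basis (F : fieldType) (n : nat) (M : 'M[F]_n) (U : {set 'I_n}) :
  balanced M U -> let A := masked_mx M U in
  exists B : {set 'I_n},
    [/\ #|B| = \rank A, (A <= mask_mx F B *m A)%MS &
      (#|U| * #|[set ij in mxsupp A | ij.1 \in B]| <= \rank A * #|mxsupp A|)%N].
Proof.
move=> balU A; pose w i := #|[set j | (i, j) \in mxsupp A]|.
have [B [cB spanB rB]] := greedy_row_basis A w.
exists B; split=> //.
have -> : #|mxsupp A| = (\sum_i w i)%N.
  rewrite (_ : \sum_i w i = \sum_(i in setT) w i)%N.
    by rewrite -card_set_rows; apply: eq_card => ij; rewrite !inE andbT.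
  by apply: eq_bigl => i; rewrite inE.
rewrite card_set_rows; apply: sum_layers => tau.
pose W := [set i | (w i <= tau)%N].
have cBW : (#|[set i in B | (tau < w i)%N]| + \rank (mask_mx F W *m A) = \rank A)%N.
  rewrite -rB -cB -cardsUI (_ : _ :&: _ = set0) ?cards0 ?addn0; last first.
    by apply/setP => i; rewrite !inE ltnNge; case: (_ <= _)%N; rewrite ?andbF.
  by apply: eq_card => i; rewrite !inE ltnNge -andb_orr orNb andbT.
have cUW : (#|U| <= #|W :&: U| + #|[set i | (tau < w i)%N]|)%N.
  apply: leq_trans (leq_card_setU _ _); apply: subset_leq_card; apply/subsetP => i iU.
  by rewrite !inE iU andbT leqNgt orNb.
have := leq_trans (balU (W :&: U)) _; rewrite -/A.
move=> /(_ _ (leq_mul (leqnn _) (rank_masked_mx_le M U W))); rewrite -/A.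
move: cUW cBW; set x := #|[set i in B | _]|; set y := #|[set i | _]|.
move: (\rank A) (\rank (_ *m A)) (#|U|) (#|_ :&: _|) => r k m z; nia.
Qed.

(** * Sparse patterns inside a matrix with nonzero diagonal *)

Definition swap (I : Type) (ij : I * I) : I * I := (ij.2, ij.1).

Lemma swap_inj (I : Type) : injective (@swap I).
Proof. by move=> [i j] [k l] [-> ->]. Qed.

Lemma mem_swap_imset (I : finType) (S : {set I * I}) ij : (ij \in @swap I @: S) = (swap ij \in S).
Proof.
by case: ij => i j; rewrite -[(i, j)]/(swap (swap (i, j))) mem_imset //; apply: swap_inj.
Qed.

Lemma mxsupp_tr (F : fieldType) (n : nat) (A : 'M[F]_n) : mxsupp A^T = @swap 'I_n @: mxsupp A.
Proof. by apply/setP => ij; rewrite mem_swap_imset !inE mxE. Qed.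

Lemma mask_mx_sub_rowsub (F : fieldType) (n p : nat) (A : 'M[F]_(n, p)) (B : {set 'I_n}) :
  (mask_mx F B *m A <= rowsub (fun a : 'I_#|B| => enum_val a) A)%MS.
Proof.
apply/mask_mx_sub => i iB; set X := rowsub _ _.
rewrite (_ : row i A = row (enum_rank_in iB i) X) ?row_sub //.
by apply/rowP => j; rewrite !mxE enum_rankK_in.
Qed.

Definition pattern_edges (n : nat) (Z : {set 'I_n * 'I_n}) : {set 'I_n * 'I_n} :=
  [set ij in all_pairs n | (ij \in Z) || (swap ij \in Z)].

(** Each edge accounts for at most two off-diagonal positions of [Z]. *)
Lemma card_pattern_edges (n : nat) (Z : {set 'I_n * 'I_n}) :
  (#|Z| <= #|[set i | (i, i) \in Z]| + 2 * #|pattern_edges Z|)%N.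
Proof.
pose diag := [set (i, i) | i in [set i | (i, i) \in Z]].
apply: (@leq_trans #|diag :|: (pattern_edges Z :|: @swap 'I_n @: pattern_edges Z)|).
  apply/subset_leq_card/subsetP => -[i j] ijZ; rewrite !in_setU mem_swap_imset !inE /swap /= !ijZ.
  case: (ltngtP i j) => [||/val_inj ij]; rewrite ?orbT //.
  by subst j; rewrite /diag imset_f // inE.
apply: (leq_trans (leq_card_setU _ _)); apply: leq_add; first exact: leq_imset_card.
by rewrite mul2n -addnn; apply: (leq_trans (leq_card_setU _ _)); rewrite leq_add2l leq_imset_card.
Qed.

(** On a balanced [U], [r] is the rank, [m] the size, [Z] the support and [t] the number of nonzero
    entries in basis rows or columns. The bound on [t * m] adds the shares of the two sparse
    bases. *)
Lemma sparse_principal_pattern (F : fieldType) (n : nat) (M : 'M[F]_n) :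
  (0 < n)%N -> (forall i, M i i != 0) ->
  exists (r t m : nat) (Z : {set 'I_n * 'I_n}),
    [/\ Z \in sparse_patterns n r t, Z \subset mxsupp M & #|[set i | (i, i) \in Z]| = m] /\
    [/\ (0 < m <= t)%N, (t <= n * n)%N, (r * n <= \rank M * m)%N,
        (t * m <= 2 * (r * #|Z|))%N & (m * m <= r * #|Z|)%N].
Proof.
move=> n0 Mdiag; have [U U0 balU] := exists_balanced M n0.
pose A := masked_mx M U.
have AE i j : A i j = (i \in U)%:R * M i j * (j \in U)%:R by exact: masked_mxE.
have [B1 [cB1 spB1 sB1]] := sparse_row_basis balU.
have [B2 [cB2 spB2 sB2]] := sparse_row_basis (balanced_tr balU).
move: cB2 spB2 sB2; rewrite -tr_masked_mx mxrank_tr -/A => cB2 spB2 sB2.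
have Apat := support_sparse_pattern (erefl _) cB1 cB2
  (submx_trans spB1 (mask_mx_sub_rowsub _ _)) (submx_trans spB2 (mask_mx_sub_rowsub _ _)).
pose R1 := [set ij in mxsupp A | ij.1 \in B1].
pose R2 := [set ij in mxsupp A^T | ij.1 \in B2].
(* The diagonal makes every column in [U] nonzero, so some basis row is nonzero there: the basis
   rows carry at least [#|U|] entries. This also yields the bound on [m * m]. *)
have UR1 : (#|U| <= #|R1|)%N.
  apply: leq_trans (leq_imset_card snd R1).
  apply/subset_leq_card/subsetP => j jU.
  have [X AX] := submxP spB1.
  have Ajj : A j j != 0 by rewrite AE jU mul1r mulr1.
  have [i /andP[iB1 Aij]] : exists i, (i \in B1) && (A i j != 0).
    apply/existsP; apply: contraTT Ajj; rewrite negb_exists => /forallP noi; apply/negPn/eqP.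
    rewrite -/A in AX; rewrite AX mxE big1 // => i _; rewrite mask_mxE.
    by have := noi i; case: (i \in B1) => [/negPn /eqP ->|_]; rewrite ?mul0r !mulr0.
  by apply/imsetP; exists (i, j) => //; rewrite !inE Aij.
have crossR : (#|cross_supp A B1 B2| <= #|R1| + #|R2|)%N.
  rewrite -(card_imset R2 (@swap_inj 'I_n)); apply: leq_trans (leq_card_setU _ _).
  apply/subset_leq_card/subsetP => ij; rewrite in_setU mem_swap_imset !inE [A^T _ _]mxE /swap /=.
  by case/andP => -> /orP[] ->; rewrite ?orbT.
have R1Z : (#|U| * #|R1| <= \rank A * #|mxsupp A|)%N by [].
have R2Z : (#|U| * #|R2| <= \rank A * #|mxsupp A|)%N.
  by rewrite -(card_imset (mxsupp A) (@swap_inj 'I_n)) -mxsupp_tr.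
exists (\rank A), #|cross_supp A B1 B2|, #|U|, (mxsupp A); split; split=> //.
- apply/subsetP => -[i j]; rewrite !inE /= AE; apply: contraNneq => ->.
  by rewrite mulr0 mul0r.
- apply: eq_card => i; rewrite !inE AE /=.
  by case: (i \in U); rewrite ?mul0r ?eqxx // mul1r mulr1 Mdiag.
- rewrite U0 (leq_trans UR1) //; apply/subset_leq_card/subsetP => ij.
  by rewrite !inE => /andP[-> ->].
- by rewrite -[X in (_ <= X * X)%N]card_ord -card_prod max_card.
(* Balance is compared with the full vertex set. *)
- have := balU setT; rewrite cardsT card_ord -/A mulnC => /leq_trans; apply.
  rewrite mulnC leq_mul2r (leq_trans (mxrankM_maxl _ _)) ?orbT //.
  exact: mxrankM_maxr.
- by rewrite mulnC (leq_trans (leq_mul (leqnn _) crossR)) // mulnDr mul2n -addnn leq_add.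
- by apply: leq_trans R1Z; rewrite leq_mul2l UR1 orbT.
Qed.

(** * Binomial random graphs *)

(** Expanding the product of [F i + G i] generates all sets [E]; those not inside [A] or missing a
    point of [H] get a zero factor. For [A] the set of all pairs, this is the probability that the
    random graph contains [H]. *)
Lemma sum_supset_weight (R : comPzRingType) (T : finType) (A H : {set T}) (p : R) :
  H \subset A ->
  \sum_(E : {set T} | (E \subset A) && (H \subset E))
     p ^+ #|E| * (1 - p) ^+ (#|A| - #|E|) = p ^+ #|H|.
Proof.
move=> HA.
pose F (i : T) : R := if i \in A then p else 0.
pose G (i : T) : R := if i \in A then (if i \in H then 0 else 1 - p) else 1.
have prodX (S : {set T}) (x : R) : \prod_i (if i \in S then x else 1) = x ^+ #|S|.
  by rewrite -big_mkcond prodr_const.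
have -> : p ^+ #|H| = \prod_i (F i + G i).
  rewrite -prodX; apply: eq_bigr => i _; rewrite /F /G.
  have [iH|_] := boolP (i \in H); first by rewrite (subsetP HA) // addr0.
  by case: ifP => _; rewrite ?add0r // addrC subrK.
rewrite bigA_distr [RHS](bigID (fun E : {set T} => (E \subset A) && (H \subset E))) /=.
rewrite [X in _ = _ + X]big1 ?addr0 => [|E]; last first.
  rewrite negb_and => /orP[/subsetPn[i iE iA]|/subsetPn[i iH iE]]; rewrite (bigD1 i) //=.
    by rewrite iE /F (negPf iA) mul0r.
  by rewrite (negPf iE) /G (subsetP HA) // iH mul0r.
apply: eq_bigr => E /andP[EA HE].
have -> : (#|A| - #|E| = #|A :\: E|)%N by rewrite cardsD (setIidPr EA).
rewrite -!prodX -big_split; apply: eq_bigr => i _ /=; rewrite in_setD /F /G.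
have [iE|iE] := boolP (i \in E); first by rewrite (subsetP EA) //= mulr1.
have -> : (i \in H) = false by apply: contraNF iE; apply: (subsetP HE).
by rewrite mul1r.
Qed.

Lemma gnp_weightE (n : nat) (p : R) (E : {set 'I_n * 'I_n}) :
  gnp_weight p E = p ^+ #|E| * (1 - p) ^+ (#|all_pairs n| - #|E|).
Proof. by rewrite /gnp_weight !RpowE. Qed.

Lemma gnp_weight_ge0 (n : nat) (p : R) (E : {set 'I_n * 'I_n}) :
  0 <= p <= 1 -> 0 <= gnp_weight p E.
Proof. by case/andP=> p0 p1; rewrite gnp_weightE mulr_ge0 // exprn_ge0 // subr_ge0. Qed.

Lemma sum_gnp_weight (n : nat) (p : R) :
  \sum_(E : {set 'I_n * 'I_n} | E \subset all_pairs n) gnp_weight p E = 1.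
Proof.
have := sum_supset_weight p (sub0set (all_pairs n)); rewrite cards0 expr0 => <-.
by apply: eq_big => E; rewrite ?sub0set ?andbT // => _; rewrite gnp_weightE.
Qed.

Lemma gnp_probE (n : nat) (p : R) (P : rel 'I_n -> Prop) :
  gnp_prob n p P =
  \sum_(E : {set 'I_n * 'I_n} | (E \subset all_pairs n) && `[< P (gadj E) >]) gnp_weight p E.
Proof.
rewrite big_mkcondr; apply: eq_bigr => E _.
by case: ClassicalEpsilon.excluded_middle_informative => PE;
  [rewrite asboolT // Rmult_1_r | rewrite asboolF // Rmult_0_r].
Qed.

Lemma gnp_prob_le1 (n : nat) (p : R) (P : rel 'I_n -> Prop) :
  0 <= p <= 1 -> gnp_prob n p P <= 1.
Proof.
move=> p01; rewrite gnp_probE -(sum_gnp_weight n p) big_mkcondr.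
by apply: ler_sum => E _; case: ifP => // _; apply: gnp_weight_ge0.
Qed.

Lemma gnp_prob_union_bound (n : nat) (p : R) (P : rel 'I_n -> Prop) (I : finType)
    (Q : pred I) (H : I -> {set 'I_n * 'I_n}) :
  0 <= p <= 1 -> (forall i, H i \subset all_pairs n) ->
  (forall E : {set 'I_n * 'I_n}, E \subset all_pairs n -> ~ P (gadj E) ->
     exists2 i, Q i & H i \subset E) ->
  1 - \sum_(i | Q i) p ^+ #|H i| <= gnp_prob n p P.
Proof.
move=> p01 HA cover; rewrite lerBlDr gnp_probE -(sum_gnp_weight n p).
under [X in _ + X]eq_bigr do rewrite -(sum_supset_weight p (HA _)) big_mkcondr.
(* After the exchange the bound is checked outcome by outcome: a bad [E] is paid for by some [H i]
   inside it. *)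
rewrite exchange_big /= big_mkcondr -big_split /=; apply: ler_sum => E EA.
have w0 := gnp_weight_ge0 E p01.
case: ifP => [_|/asboolPn /(cover E EA)[i Qi HiE]].
  rewrite lerDl; apply: sumr_ge0 => i _; case: ifP => // _.
  by rewrite -gnp_weightE.
rewrite add0r (bigD1 i) //= HiE -gnp_weightE lerDl; apply: sumr_ge0 => j _.
by case: ifP => // _; rewrite -gnp_weightE.
Qed.

(** A pair of [r] and [t] contributes at most [n ^ (18 * t)] terms of size at most
    [1 / n ^ (25 * t)], in total at most [1 / n ^ 7]. The number of pairs, [(n + 1) * (n * n + 1)],
    is at most [n ^ 2 * n ^ 4]. *)
Lemma sum_sparse_patterns_le (n : nat) (w : {set 'I_n * 'I_n} -> R) :
  (2 <= n)%N ->
  \sum_(x : 'I_n.+1 * 'I_(n * n).+1 * {set 'I_n * 'I_n} |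
        [&& x.2 \in sparse_patterns n x.1.1 x.1.2, (0 < x.1.2)%N, (x.1.1 <= x.1.2)%N &
            w x.2 <= n%:R^-1 ^+ (25 * x.1.2)])
    w x.2 <= n%:R^-1.
Proof.
move=> n2; have n0 : (0 < n)%N by apply: leq_trans n2.
have ni0 : 0 <= n%:R^-1 :> R by rewrite invr_ge0 ler0n.
have ni1 : n%:R^-1 <= 1 :> R by rewrite invf_le1 ?ltr0n // ler1n.
pose c := (fun rt : 'I_n.+1 * 'I_(n * n).+1 => (0 < rt.2)%N && (rt.1 <= rt.2)%N).
pose d (rt : 'I_n.+1 * 'I_(n * n).+1) Z :=
  (Z \in sparse_patterns n rt.1 rt.2) && (w Z <= n%:R^-1 ^+ (25 * rt.2)).
rewrite (eq_bigl (fun x => c x.1 && d x.1 x.2)); last first.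
  by move=> x; rewrite /c /d andbACA -!andbA; do !bool_congr.
rewrite -(pair_big_dep c d (fun _ Z => w Z)) /=.
apply: (@le_trans _ _ (\sum_(rt : 'I_n.+1 * 'I_(n * n).+1) n%:R^-1 ^+ 7)).
  rewrite [X in X <= _]big_mkcond; apply: ler_sum => -[r t] _; case: ifP; last first.
    by move=> _; apply: exprn_ge0.
  rewrite /c /= => /andP[t0 rt].
  apply: (@le_trans _ _ (\sum_(Z in sparse_patterns n r t) n%:R^-1 ^+ (25 * t))).
    rewrite big_mkcondr; apply: ler_sum => Z _; case: ifP => // _.
    exact: exprn_ge0.
  rewrite sumr_const -[X in X <= _]mulr_natl.
  apply: (@le_trans _ _ ((n ^ (18 * t))%:R * n%:R^-1 ^+ (25 * t))).
    apply: ler_wpM2r; first exact: exprn_ge0.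
    by rewrite ler_nat card_sparse_patterns // -ltnS.
  rewrite (_ : 25 * t = 18 * t + 7 * t)%N; last lia.
  rewrite exprD mulrA natrX -exprMn divff ?pnatr_eq0 -?lt0n // expr1n mul1r.
  by rewrite exprM; apply: ler_iXnr; rewrite ?exprn_ge0 ?exprn_ile1.
rewrite sumr_const card_prod !card_ord -[X in X <= _]mulr_natl.
rewrite -[X in _ <= X]mul1r exprSr mulrA; apply: ler_wpM2r => //.
rewrite exprVn ler_pdivrMr ?exprn_gt0 ?ltr0n // mul1r -natrX ler_nat.
rewrite -[6%N]/(2 + 4)%N expnD; apply: leq_mul.
  by rewrite !expnS expn0; nia.
by rewrite !expnS expn0; nia.
Qed.

Local Open Scope R_scope.

(** * Numerical estimates *)

Lemma INR_addn (a b : nat) : INR (a + b)%N = INR a + INR b.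
Proof. exact: plus_INR. Qed.

Lemma INR_muln (a b : nat) : INR (a * b)%N = INR a * INR b.
Proof. exact: mult_INR. Qed.

Lemma pow_exp_ln (x : R) (k : nat) : 0 < x -> x ^ k = exp (INR k * ln x).
Proof. by move=> x0; rewrite -Rpower_pow. Qed.

Lemma exp_monotone (x y : R) : x <= y -> exp x <= exp y.
Proof. by case=> [xy|->]; [apply/Rlt_le/exp_increasing | apply: Rle_refl]. Qed.

(* With [theta = ln (1/p) / (200 ln n)] the hypotheses give [r < theta m],
   [m <= theta s], hence [s <= 4 e], and [t <= 2 theta s <= 8 theta e]. *)
Lemma pattern_weight_le (n k r t m s e : nat) (p : R) :
  (2 <= n)%N -> / INR n <= p -> p <= 1 ->
  INR k < / 200 * INR n * ln (/ p) / ln (INR n) ->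
  (0 < m)%N -> (r * n <= k * m)%N -> (t * m <= 2 * (r * s))%N ->
  (m * m <= r * s)%N -> (s <= m + 2 * e)%N ->
  p ^ e <= (/ INR n) ^ (25 * t).
Proof.
move=> n2 np p1 kub m0 /ssrnat.leP/le_INR rn /ssrnat.leP/le_INR tm
  /ssrnat.leP/le_INR mm /ssrnat.leP/le_INR sme.
move: rn tm mm sme; rewrite INR_addn !INR_muln (_ : INR 2 = 2) // => rn tm mm sme.
have n2R : 2 <= INR n by apply: (le_INR 2); apply/ssrnat.leP.
have m0R : 0 < INR m by apply: lt_0_INR; apply/ssrnat.ltP.
have in0 : 0 < / INR n by apply: Rinv_0_lt_compat; Lra.lra.
have p0 : 0 < p by Lra.lra.
have lnn : 0 < ln (INR n) by rewrite -ln_1; apply: ln_increasing; Lra.lra.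
(* The lower bound on [p] gives this, and thereby [theta <= 1 / 200]. *)
have Lle : ln (/ p) <= ln (INR n).
  have ipn : / p <= INR n.
    by rewrite -(Rinv_inv (INR n)); apply: Rinv_le_contravar.
  case: ipn => [ipn|->]; last exact: Rle_refl.
  by apply/Rlt_le/ln_increasing => //; apply: Rinv_0_lt_compat.
pose theta := ln (/ p) / (200 * ln (INR n)).
have kth : INR k < theta * INR n.
  by apply: Rlt_le_trans kub _; apply/Req_le; rewrite /theta; field; Lra.lra.
have thL : theta * (200 * ln (INR n)) = ln (/ p) by rewrite /theta; field; Lra.lra.
have rth : INR r < theta * INR m.
  apply: (Rmult_lt_reg_r (INR n)); first Lra.lra.
  apply: (Rle_lt_trans _ _ _ rn).
  rewrite (_ : theta * INR m * INR n = theta * INR n * INR m); last ring.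
  exact: Rmult_lt_compat_r.
have th200 : theta <= / 200.
  apply: (Rmult_le_reg_r (200 * ln (INR n))); first Lra.lra.
  by rewrite thL; Lra.lra.
have r0 := pos_INR r; have s0 := pos_INR s; have e0 := pos_INR e; have t0 := pos_INR t.
(* The strict bound on [k] excludes [p = 1]. *)
have th0 : 0 < theta.
  by apply: (Rmult_lt_reg_r (INR m)) => //; rewrite Rmult_0_l; apply: Rle_lt_trans rth.
have rs : INR r * INR s <= theta * INR m * INR s by apply: Rmult_le_compat_r => //; Lra.lra.
have mth : INR m <= theta * INR s.
  apply: (Rmult_le_reg_r (INR m)) => //; apply: Rle_trans mm _; apply: Rle_trans rs _.
  by apply: Req_le; ring.
have ms : INR m <= / 200 * INR s.
  by apply: Rle_trans mth _; apply: Rmult_le_compat_r.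
have se : INR s <= 4 * INR e by Lra.lra.
have tth : INR t <= 2 * theta * INR s.
  apply: (Rmult_le_reg_r (INR m)) => //; apply: Rle_trans tm _.
  rewrite (_ : 2 * theta * INR s * INR m = 2 * (theta * INR m * INR s)); last ring.
  by apply: Rmult_le_compat_l => //; Lra.lra.
have te : INR t <= 8 * theta * INR e.
  by apply: Rle_trans tth _; Lra.nra.
rewrite !pow_exp_ln // INR_muln; apply: exp_monotone.
rewrite ln_Rinv; last Lra.lra.
have -> : ln p = - ln (/ p) by rewrite ln_Rinv //; ring.
rewrite -thL.
(* The product [25 * 8] is the 200 in [theta]. *)
have := Rmult_le_compat_r (ln (INR n)) _ _ (Rlt_le _ _ lnn) te.
rewrite (_ : INR 25 = 25); last by rewrite /=; ring.
Lra.lra.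
Qed.

(** * From small minrank to the failure probability *)

Lemma minrankP (F : fieldType) (n : nat) (adj : rel 'I_n) :
  exists2 M : 'M[F]_n, represents adj M & \rank M = minrank F adj.
Proof.
rewrite /minrank; case: ex_minnP => k; rewrite /mr_pred.
by case: excluded_middle_informative => // -[M [Madj rM]] _ _; exists M.
Qed.

Lemma pattern_edges_sub (F : fieldType) (n : nat) (E Z : {set 'I_n * 'I_n}) (M : 'M[F]_n) :
  E \subset all_pairs n -> represents (gadj E) M -> Z \subset mxsupp M ->
  pattern_edges Z \subset E.
Proof.
move=> /subsetP EA [_ M0] /subsetP ZM; apply/subsetP => -[i j].
rewrite !inE /= => /andP[ij ijZ].
have nij : i != j by rewrite neq_ltn ij.
have ME a b : (a, b) \in Z -> a != b -> gadj E a b.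
  by move=> /ZM; rewrite inE /= => Mab ab; apply: contraNT Mab => nadj; apply/eqP/M0.
have : gadj E i j.
  by case/orP: ijZ => /ME; [apply | rewrite eq_sym /gadj orbC; apply].
by case/orP => // /EA; rewrite inE /= ltnNge ltnW.
Qed.

Lemma gnp_minrank_prob (n : nat) (p : R) :
  (2 <= n)%N -> / INR n <= p -> p <= 1 ->
  1 - / INR n <=
  gnp_prob n p (fun adj => forall F : fieldType,
    / 200 * INR n * ln (/ p) / ln (INR n) <= INR (minrank F adj)) <= 1.
Proof.
move=> n2 np p1; have n0 : (0 < n)%N by apply: leq_trans n2.
have p01 : (0 <= p <= 1)%R.
  apply/andP; split; last exact/RleP.
  apply/RleP; apply: Rle_trans np; apply/Rlt_le/Rinv_0_lt_compat/lt_0_INR; exact/ssrnat.ltP.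
split; last by apply/RleP/gnp_prob_le1.
pose w (Z : {set 'I_n * 'I_n}) : R := (p ^+ #|pattern_edges Z|)%R.
pose idx := ('I_n.+1 * 'I_(n * n).+1 * {set 'I_n * 'I_n})%type.
apply: (@Rle_trans _ (1 - \sum_(x : idx |
     [&& x.2 \in sparse_patterns n x.1.1 x.1.2, (0 < x.1.2)%N, (x.1.1 <= x.1.2)%N &
         w x.2 <= n%:R^-1 ^+ (25 * x.1.2)]) w x.2)%R); apply/RleP.
  by rewrite INRE RinvE lerD2l lerN2; apply: sum_sparse_patterns_le.
apply: (gnp_prob_union_bound (H := fun x : idx => pattern_edges x.2)) => //.
  by move=> x; apply/subsetP => ij; rewrite inE => /andP[].
(* Failure provides some field [F], but the index built from it mentions no field, so ranging over
   all fields costs nothing in the union bound. *)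
move=> E EA /existsNP[F /Rnot_le_lt small].
have [M Madj rM] := minrankP F (gadj E); have [Mdiag _] := Madj.
have [r [t [m [Z [[Zpat ZM Zm] [/andP[m0 mt] tn rn tm mm]]]]]] := sparse_principal_pattern n0 Mdiag.
(* The rank of [M] is at most [n], so [r * n <= n * m]. *)
have rm : (r <= m)%N.
  by rewrite -(leq_pmul2r n0) (leq_trans rn) // mulnC leq_mul2l rank_leq_row orbT.
have rlen : (r <= n)%N.
  by rewrite (leq_trans rm) // -Zm -[X in (_ <= X)%N]card_ord max_card.
exists (Ordinal (rlen : (r < n.+1)%N), Ordinal (tn : (t < (n * n).+1)%N), Z); last first.
  exact: (pattern_edges_sub EA Madj ZM).
rewrite Zpat (leq_trans m0 mt) (leq_trans rm mt) /= /w -INRE -RinvE -!RpowE.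
apply/RleP; apply: (pattern_weight_le n2 np p1 _ m0 rn tm mm).
  by rewrite rM.
by rewrite -Zm card_pattern_edges.
Qed.

Theorem theorem5p1 :
  exists c : R, 0 < c /\
    forall p : nat -> R,
      (forall n : nat, (1 <= n)%N -> / INR n <= p n /\ p n <= 1) ->
      Un_cv (fun n : nat =>
               gnp_prob n (p n)
                 (fun adj : rel 'I_n =>
                    forall F : fieldType,
                      c * INR n * ln (/ p n) / ln (INR n) <= INR (minrank F adj)))
            1.
Proof.
exists (/ 200); split=> [|p hp eps eps0]; first Lra.lra.
have [N [Neps N0]] := archimed_cor1 eps eps0.
(* From 2 on, [ln (INR n)] is positive; from [N] on, the failure probability [1 / n] is below
   [eps]. *)
exists (maxn 2 N) => n /ssrnat.leP; rewrite geq_max => /andP[n2 nN].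
have [np p1] := hp n (ltnW n2).
have [lo hi] := gnp_minrank_prob n2 np p1.
have inN : / INR n <= / INR N.
  apply: Rinv_le_contravar; first exact: lt_0_INR.
  by apply: le_INR; apply/ssrnat.leP.
by rewrite /R_dist; apply: Rabs_def1; Lra.lra.
Qed.
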